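(* Let $h(y)$ be a delta series and $l(y)$ an invertible series over $\mathbb{C}$, and let $\{{}_sA_n(x)\}_{n\ge 0}$ be the Sheffer-Appell polynomial sequence for the pair $(l(y),h(y))$. Then for every integer $n\ge 0$, $${}_sA_{n+1}(x)=\sum_{k=0}^{n}\binom{n}{k}(x a_k+b_k+c_k)\,{}_sA_{n-k}(x),$$ where, for $k\ge 0$, $$a_k=\left(\frac{1}{h'(h^{-1}(y))}\right)^{(k)}\Bigg|_{y=0},\qquad b_k=\left(-\frac{l'(y)}{l(y)}\right)^{(k)}\Bigg|_{y=0},\qquad c_k=\left(-\frac{l'(h^{-1}(y))}{h'(h^{-1}(y))\,l(h^{-1}(y))}\right)^{(k)}\Bigg|_{y=0}.$$
   Context: All series are power series in $y$ over $\mathbb{C}$, of the form $\sum_{r\ge 0}\alpha_r y^r/r!$. A delta series is a power series $h(y)$ with $h(0)=0$ and $h'(0)\neq 0$; an invertible series is a power series $l(y)$ with $l(0)\neq 0$. $h^{-1}(y)$ denotes the compositional inverse of $h(y)$, i.e. $h^{-1}(h(y))=h(h^{-1}(y))=y$. The Sheffer-Appell polynomial sequence $\{{}_sA_n(x)\}_{n\ge0}$ for the pair $(l(y),h(y))$, written ${}_sA_n(x)\sim(l(y),h(y))$, is defined by the generating function $$\frac{1}{l(h^{-1}(y))\,l(y)}\,e^{x h^{-1}(y)}=\sum_{n=0}^{\infty}{}_sA_n(x)\,\frac{y^n}{n!}.$$ For a series $g(y)$, $(g(y))^{(k)}|_{y=0}$ denotes its $k$th derivative with respect to $y$ evaluated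 at $y=0$; $h'(h^{-1}(y))$ and $l'(h^{-1}(y))$ mean $h'$ and $l'$ evaluated at $h^{-1}(y)$. *)

(* Defs.v *)
From HB Require Import structures.
From mathcomp Require Import all_boot all_order all_algebra.
From mathcomp Require Import boolp classical_sets reals.
From mathcomp Require Export complex.

Set Implicit Arguments.
Unset Strict Implicit.
Unset Printing Implicit Defensive.

Import GRing.Theory.
Local Open Scope ring_scope.

(* Formal power series: [f k] is the ordinary coefficient of
   y^k in f, that is alpha_k / k! when f is written as
   sum_r alpha_r y^r / r!. *)
Record fps (R : Type) := Fps { coef_fps :> nat -> R }.

Section FpsZmodule.
Variable R : zmodType.
Implicit Types f g : fps R.

HB.instance Definition _ := gen_eqMixin (fps R).
HB.instance Definition _ := gen_choiceMixin (fps R).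

Lemma fpsP f g : (forall n, f n = g n) <-> f = g.
Proof.
split=> [|-> //]; case: f g => [f] [g] /= fg; congr Fps.
exact/funext.
Qed.

Definition zero_fps : fps R := Fps (fun=> 0).
Definition opp_fps f : fps R := Fps (fun n => - f n).
Definition add_fps f g : fps R := Fps (fun n => f n + g n).

Fact add_fpsA : associative add_fps.
Proof. by move=> f g h; apply/fpsP => n; rewrite /= addrA. Qed.
Fact add_fpsC : commutative add_fps.
Proof. by move=> f g; apply/fpsP => n; rewrite /= addrC. Qed.
Fact add_0fps : left_id zero_fps add_fps.
Proof. by move=> f; apply/fpsP => n; rewrite /= add0r. Qed.
Fact add_Nfps : left_inverse zero_fps opp_fps add_fps.
Proof. by move=> f; apply/fpsP => n; rewrite /= addNr. Qed.

HB.instance Definition _ :=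
  GRing.isZmodule.Build (fps R) add_fpsA add_fpsC add_0fps add_Nfps.

Lemma coef_fps0 n : (0 : fps R) n = 0. Proof. by []. Qed.
Lemma coef_fpsN f n : (- f) n = - f n. Proof. by []. Qed.
Lemma coef_fpsD f g n : (f + g) n = f n + g n. Proof. by []. Qed.
Lemma coef_fps_sum I (r : seq I) (P : pred I) (F : I -> fps R) n :
  (\sum_(i <- r | P i) F i) n = \sum_(i <- r | P i) F i n.
Proof. exact: (big_morph (fun f : fps R => f n)). Qed.

End FpsZmodule.

Section FpsRing.
Variable R : comNzRingType.
Implicit Types f g h : fps R.

Definition fpsC (a : R) : fps R := Fps (fun n => if n == 0%N then a else 0).
Definition fpsX : fps R := Fps (fun n => (n == 1%N)%:R).
Definition mul_fps f g : fps R :=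
  Fps (fun n => \sum_(j < n.+1) f j * g (n - j)%N).

Local Definition tr m f : {poly R} := \poly_(i < m) f i.

Local Lemma coef_tr m f n : (n < m)%N -> (tr m f)`_n = f n.
Proof. by rewrite coef_poly => ->. Qed.

Local Lemma coef_trM m f g n :
  (n < m)%N -> (tr m f * tr m g)`_n = (mul_fps f g) n.
Proof.
move=> nm; rewrite coefM; apply: eq_bigr => j _.
by rewrite !coef_tr // (leq_ltn_trans _ nm) ?leq_subr // -ltnS ltn_ord.
Qed.

Fact mul_fpsC : commutative mul_fps.
Proof.
by move=> f g; apply/fpsP => n; rewrite -!(@coef_trM n.+1) // mulrC.
Qed.

Fact mul_fpsA : associative mul_fps.
Proof.
move=> f g h; apply/fpsP => n; pose p := tr n.+1.
transitivity ((p f * (p g * p h))`_n); last first.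
  rewrite mulrA coefM; apply: eq_bigr => j _.
  by rewrite coef_trM ?coef_tr // ltnS leq_subr.
rewrite coefM; apply: eq_bigr => j _.
by rewrite coef_trM ?coef_tr // ltnS leq_subr.
Qed.

Fact mul_1fps : left_id (fpsC 1) mul_fps.
Proof.
move=> f; apply/fpsP => n /=; rewrite big_ord_recl /= mul1r subn0.
by rewrite big1 ?addr0 // => i _; rewrite mul0r.
Qed.

Fact mul_fpsDl : left_distributive mul_fps +%R.
Proof.
move=> f g h; apply/fpsP => n; rewrite /= -big_split /=.
by apply: eq_bigr => j _; rewrite mulrDl.
Qed.

Fact one_fps_neq0 : fpsC 1 != 0.
Proof.
by apply/eqP => /fpsP /(_ 0%N) /eqP; rewrite coef_fps0 /= oner_eq0.
Qed.

HB.instance Definition _ := GRing.Zmodule_isComNzRing.Build (fps R)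
  mul_fpsA mul_fpsC mul_1fps mul_fpsDl one_fps_neq0.

Lemma coef_fps1 n : (1 : fps R) n = (n == 0%N)%:R.
Proof. by case: n. Qed.

Lemma coef_fpsM f g n : (f * g) n = \sum_(j < n.+1) f j * g (n - j)%N.
Proof. by []. Qed.

Lemma coef_fpsM0 f g : (f * g) 0%N = f 0%N * g 0%N.
Proof. by rewrite coef_fpsM big_ord1. Qed.

Fact fpsC_is_additive : additive fpsC.
Proof.
by move=> a b; apply/fpsP => -[|n]; rewrite coef_fpsD coef_fpsN //= subr0.
Qed.

Lemma coef_fpsCM a f n : (fpsC a * f) n = a * f n.
Proof.
rewrite coef_fpsM big_ord_recl /= subn0 big1 ?addr0 // => i _.
by rewrite mul0r.
Qed.

Fact fpsC_is_monoid_morphism : monoid_morphism fpsC.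
Proof.
split=> // a b; apply/fpsP => n; rewrite coef_fpsCM /=.
by case: eqP; rewrite ?mulr0.
Qed.

HB.instance Definition _ :=
  GRing.isZmodMorphism.Build R (fps R) fpsC fpsC_is_additive.
HB.instance Definition _ :=
  GRing.isMonoidMorphism.Build R (fps R) fpsC fpsC_is_monoid_morphism.

Lemma coef_fpsXn_lt g k n : g 0%N = 0 -> (n < k)%N -> (g ^+ k) n = 0.
Proof.
move=> g0; elim: k n => // k IHk n; rewrite ltnS => nk.
rewrite exprS coef_fpsM big1 // => -[[|j] /= lt_j] _; first by rewrite g0 mul0r.
rewrite IHk ?mulr0 //; case: n nk lt_j => [|n] nk // _.
by rewrite subSS (leq_ltn_trans (leq_subr _ _)).
Qed.

Definition fps_deriv f : fps R := Fps (fun n => f n.+1 *+ n.+1).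

(* The value at y = 0 of the k-th derivative of f. *)
Definition fps_deriv_at0 k f : R := (iter k fps_deriv f) 0%N.

(* The composite f(g(y)). It is meaningful only when g(0) = 0: the terms
   f_k g(y)^k with k > n then do not contribute to the coefficient of y^n. *)
Definition fps_comp f g : fps R :=
  Fps (fun n => \sum_(k < n.+1) f k * (g ^+ k) n).

Lemma coef_fps_comp f g n :
  (fps_comp f g) n = \sum_(k < n.+1) f k * (g ^+ k) n.
Proof. by []. Qed.

Lemma fps_comp_wide f g m n : g 0%N = 0 -> (n < m)%N ->
  (fps_comp f g) n = \sum_(k < m) f k * (g ^+ k) n.
Proof.
move=> g0 nm; rewrite /= (big_ord_widen m (fun k => f k * (g ^+ k) n)) //.
rewrite [RHS](bigID (fun k : 'I_m => (k < n.+1)%N)) /=.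
rewrite [X in _ + X]big1 ?addr0 // => k; rewrite -leqNgt => nk.
by rewrite coef_fpsXn_lt ?mulr0.
Qed.

Local Definition ev g (p : {poly R}) : fps R := (map_poly fpsC p).[g].

Local Lemma evE g p m n : g 0%N = 0 -> (n < m)%N ->
  (ev g p) n = \sum_(k < m) p`_k * (g ^+ k) n.
Proof.
move=> g0 nm; pose F k := p`_k * (g ^+ k) n.
have s0 : (size (map_poly fpsC p) <= maxn m (size p))%N.
  by rewrite (leq_trans (size_poly _ _)) // leq_maxr.
rewrite /ev (horner_coef_wide _ s0) coef_fps_sum.
rewrite (eq_bigr (fun k : 'I__ => F k)) => [|k _]; last first.
  by rewrite coef_map coef_fpsCM.
rewrite [RHS](big_ord_widen (maxn m (size p)) F) ?leq_maxl //.
rewrite [LHS](bigID (fun k : 'I__ => (k < m)%N)) /=.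
rewrite [X in _ + X]big1 ?addr0 // => k; rewrite -leqNgt => mk.
by rewrite /F coef_fpsXn_lt ?mulr0 // (leq_trans nm).
Qed.

Local Lemma comp_ev f g m n : g 0%N = 0 -> (n < m)%N ->
  (fps_comp f g) n = (ev g (tr m f)) n.
Proof.
move=> g0 nm; rewrite (fps_comp_wide _ g0 nm) (evE _ g0 nm).
by apply: eq_bigr => k _; rewrite coef_tr.
Qed.

Lemma fps_comp1 g : fps_comp 1 g = 1.
Proof.
apply/fpsP => n; rewrite coef_fps_comp big_ord_recl coef_fps1 mul1r expr0.
by rewrite big1 ?addr0 // => k _; rewrite coef_fps1 mul0r.
Qed.

Lemma fps_compM f1 f2 g : g 0%N = 0 ->
  fps_comp (f1 * f2) g = fps_comp f1 g * fps_comp f2 g.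
Proof.
move=> g0; apply/fpsP => n.
transitivity ((ev g (tr n.+1 f1 * tr n.+1 f2)) n).
  rewrite (evE _ g0 (ltnSn n)); apply: eq_bigr => k _.
  by rewrite coef_trM.
rewrite /ev rmorphM hornerM !coef_fpsM; apply: eq_bigr => j _.
by rewrite -!comp_ev // ltnS leq_subr.
Qed.

Lemma fps_compX f g k : g 0%N = 0 -> fps_comp (f ^+ k) g = fps_comp f g ^+ k.
Proof.
move=> g0; elim: k => [|k IHk]; first by rewrite !expr0 fps_comp1.
by rewrite !exprS fps_compM // IHk.
Qed.

Lemma fps_comp_coef0 f g : (fps_comp f g) 0%N = f 0%N.
Proof. by rewrite coef_fps_comp big_ord1 expr0 coef_fps1 mulr1. Qed.

Lemma fps_compA f g h : g 0%N = 0 -> h 0%N = 0 ->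
  fps_comp f (fps_comp g h) = fps_comp (fps_comp f g) h.
Proof.
move=> g0 h0; apply/fpsP => n; rewrite !coef_fps_comp.
under eq_bigr => k _ do rewrite -fps_compX // coef_fps_comp mulr_sumr.
rewrite exchange_big; apply: eq_bigr => i _.
rewrite (fps_comp_wide _ g0 (ltn_ord i)).
by rewrite mulr_suml; apply: eq_bigr => k _; rewrite mulrA.
Qed.

Lemma fps_compfX f : fps_comp f fpsX = f.
Proof.
have XnE k n : (fpsX ^+ k) n = (n == k)%:R.
  elim: k n => [|k IHk] n; first by rewrite expr0 coef_fps1.
  rewrite exprS coef_fpsM; case: n => [|n]; first by rewrite big_ord1 mul0r.
  rewrite !big_ord_recl /= mul0r add0r mul1r subSS subn0 IHk big1 ?addr0 //.
  by move=> i _; rewrite mul0r.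
apply/fpsP => n; rewrite coef_fps_comp (bigD1 ord_max) //= XnE eqxx mulr1 big1 ?addr0 //.
by move=> k /negPf nk; rewrite XnE [n == k]eq_sym (_ : (k == n :> nat) = false) ?mulr0.
Qed.

Lemma fps_compXf g : g 0%N = 0 -> fps_comp fpsX g = g.
Proof.
move=> g0; apply/fpsP => -[|n]; first by rewrite fps_comp_coef0.
rewrite coef_fps_comp !big_ord_recl mul0r add0r mul1r expr1 big1 ?addr0 // => i _.
by rewrite mul0r.
Qed.

Definition is_fps_compinv h g : Prop :=
  [/\ g 0%N = 0, fps_comp h g = fpsX & fps_comp g h = fpsX].

(* Existence and uniqueness for h(0) = 0, h'(0) invertible: see fps_compinvP
   and is_fps_compinv_unique; the value 0 is a default otherwise. *)
Definition fps_compinv h : fps R := xget 0 (is_fps_compinv h).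

End FpsRing.

(* [course_of F] is the g with g n = F (g restricted to {0,..,n-1}) n. *)
Section CourseOf.
Variables (R : zmodType) (F : (nat -> R) -> nat -> R).

Fixpoint course_seq n : seq R :=
  if n is m.+1 then rcons (course_seq m) (F (nth 0 (course_seq m)) m) else [::].
Definition course_of n : R := nth 0 (course_seq n.+1) n.

Lemma course_ofE n :
  course_of n = F (fun j => if (j < n)%N then course_of j else 0) n.
Proof.
have sz m : size (course_seq m) = m by elim: m => //= m IH; rewrite size_rcons IH.
have nthE m j : (j < m)%N -> nth 0 (course_seq m) j = course_of j.
  elim: m => // m IH; rewrite ltnS leq_eqVlt => /predU1P[-> //|jm].
  by rewrite /= nth_rcons sz jm IH.
rewrite {1}/course_of /= nth_rcons sz ltnn eqxx; congr F; apply/funext => j.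
by case: ltnP => jn; [rewrite nthE | rewrite nth_default ?sz].
Qed.

End CourseOf.

Section FpsUnitRing.
Variable R : comUnitRingType.
Implicit Types f g h : fps R.

Definition unit_fps : {pred fps R} := fun f => f 0%N \is a GRing.unit.
Definition inv_fps f : fps R :=
  if f \in unit_fps then
    Fps (course_of (fun u n =>
      (f 0%N)^-1 * ((n == 0%N)%:R - \sum_(j < n) u j * f (n - j)%N)))
  else f.

Fact mul_Vfps : {in unit_fps, left_inverse 1 inv_fps *%R}.
Proof.
move=> f Uf; apply/fpsP => n; rewrite coef_fps1 /inv_fps Uf coef_fpsM /=.
rewrite big_ord_recr /= subnn course_ofE mulrC mulrA mulrV // mul1r.
rewrite [X in _ + (_ - X)](eq_bigr (fun j : 'I_n => course_of (fun u n =>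
      (f 0%N)^-1 * ((n == 0%N)%:R - \sum_(j < n) u j * f (n - j)%N)) j * f (n - j)%N)).
  by rewrite addrC subrK.
by move=> j _; rewrite ltn_ord.
Qed.

Fact unit_fpsPl f g : g * f = 1 -> unit_fps f.
Proof.
move=> /fpsP /(_ 0%N); rewrite coef_fpsM0 coef_fps1 /= => gf.
by apply/unitrPr; exists (g 0%N); rewrite mulrC.
Qed.

Fact inv_fps_out : {in [predC unit_fps], inv_fps =1 id}.
Proof. by move=> f /negPf nUf; rewrite /inv_fps [f \in _]nUf. Qed.

HB.instance Definition _ := GRing.ComNzRing_hasMulInverse.Build (fps R)
  mul_Vfps unit_fpsPl inv_fps_out.

Lemma unit_fpsE f : (f \is a GRing.unit) = (f 0%N \is a GRing.unit).
Proof. by []. Qed.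

(* e^y. This is used over {poly K} too, where, K being a field of
   characteristic 0, (n`!%:R)^-1 is the constant polynomial 1 / n`!. *)
Definition fps_exp : fps R := Fps (fun n => (n`!%:R)^-1).

Local Definition rinv h : fps R := Fps (course_of (fun u n =>
  (h 1%N)^-1 * ((n == 1%N)%:R - \sum_(2 <= k < n.+1) h k * (Fps u ^+ k) n))).

Local Lemma rinv_spec h : h 0%N = 0 -> h 1%N \is a GRing.unit ->
  [/\ rinv h 0%N = 0, rinv h 1%N = (h 1%N)^-1 & fps_comp h (rinv h) = fpsX R].
Proof.
move=> h0 Uh; set g := rinv h.
have g0 : g 0%N = 0.
  by rewrite /g /= course_ofE /= big_geq // subr0 mulr0.
have g1 : g 1%N = (h 1%N)^-1.
  by rewrite /g /= course_ofE /= big_geq // subr0 mulr1.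
split=> //; apply/fpsP => -[|n]; first by rewrite fps_comp_coef0.
pose gt : fps R := Fps (fun j => if (j < n.+1)%N then g j else 0).
(* below index n+1, g ^+ k.+2 only involves the coefficients of gt *)
have gt_low k m : (m <= n)%N -> (g ^+ k) m = (gt ^+ k) m.
  elim: k m => [|k IHk] m mn; first by rewrite !expr0.
  rewrite !exprS !coef_fpsM; apply: eq_bigr => j _.
  rewrite /= ltnS (leq_trans _ mn) ?IHk // ?(leq_trans (leq_subr _ _)) //.
  by rewrite -ltnS ltn_ord.
have gt0 : gt 0%N = 0 by exact: g0.
have gt_pow k : (g ^+ k.+2) n.+1 = (gt ^+ k.+2) n.+1.
  rewrite ![_ ^+ k.+2]exprS !coef_fpsM big_ord_recl [RHS]big_ord_recl g0 gt0 !mul0r.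
  congr (_ + _); apply: eq_bigr => j _; rewrite /= /bump /= add1n subSS.
  rewrite !gt_low ?leq_subr //; case: ltnP => // nj.
  have /eqP: j = n :> nat.
    by apply/eqP; rewrite eqn_leq -ltnS ltn_ord -ltnS.
  move=> /eqP ->; rewrite subnn coef_fpsXn_lt ?mulr0 ?mul0r //.
rewrite /= big_ord_recl h0 mul0r add0r big_ord_recl expr1 /bump /=.
rewrite {1}/g {1}/rinv /= course_ofE mulrA mulrV // mul1r.
rewrite big_add1 big_add1 /= big_mkord -/gt.
rewrite -[X in _ - X](_ : \sum_(i < n) h i.+2 * (g ^+ i.+2) n.+1 = _).
  by rewrite subrK.
by apply: eq_bigr => i _; rewrite gt_pow.
Qed.

Lemma fps_compinvP h : h 0%N = 0 -> h 1%N \is a GRing.unit ->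
  is_fps_compinv h (fps_compinv h).
Proof.
move=> h0 Uh; apply: (@xgetPex _ _ (is_fps_compinv h)).
have [g0 g1 hg] := rinv_spec h0 Uh.
have Ug : rinv h 1%N \is a GRing.unit by rewrite g1 unitrV.
have [k0 _ gk] := rinv_spec g0 Ug.
exists (rinv h); split=> //.
suff {2}-> : h = rinv (rinv h) by [].
by rewrite -[LHS]fps_compfX -gk fps_compA // hg fps_compXf.
Qed.

Lemma is_fps_compinv_unique h g1 g2 : h 0%N = 0 ->
  is_fps_compinv h g1 -> is_fps_compinv h g2 -> g1 = g2.
Proof.
move=> h0 [g10 hg1 g1h] [g20 hg2 g2h].
by rewrite -[LHS]fps_compfX -hg2 fps_compA // g1h fps_compXf.
Qed.

End FpsUnitRing.

Definition map_fps (R S : Type) (phi : R -> S) (f : fps R) : fps S :=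
  Fps (fun n => phi (f n)).

Definition delta_series (K : fieldType) (h : fps K) : Prop :=
  h 0%N = 0 /\ (fps_deriv h) 0%N != 0.

Definition invertible_series (K : fieldType) (l : fps K) : Prop := l 0%N != 0.

(* Series in y whose coefficients are polynomials in x: x is 'X, and series
   over K are embedded through polyC. *)
Definition sheffer_appell (K : fieldType) (l h : fps K)
    (sA : nat -> {poly K}) : Prop :=
  map_fps polyC (fps_comp l (fps_compinv h) * l)^-1
    * fps_comp (fps_exp {poly K}) (fpsC 'X * map_fps polyC (fps_compinv h))
  = Fps (fun n => (n`!%:R)^-1 *: sA n).

(* Main.v *)
(** The generating series [F] of the sequence satisfies the first-order equation
    [F' = F * (x g' - l'(g) g' / l(g) - l' / l)], where [g] is the compositional
    inverse of [h]; moreover [g' = 1 / h'(g)] by the chain rule applied to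
    [h(g(y)) = y]. The recurrence is the comparison of the coefficients of [y^n]
    on both sides. *)
From HB Require Import structures.
Require Import Defs.
From mathcomp Require Import all_boot all_order all_algebra.
From mathcomp Require Import reals complex.
From mathcomp Require Import ring.
Import GRing.Theory.
Local Open Scope ring_scope.

Set Implicit Arguments.
Unset Strict Implicit.

Section Derivative.
Variable R : comNzRingType.
Implicit Types f g h : fps R.

Lemma coef_fps_deriv f n : fps_deriv f n = f n.+1 *+ n.+1.
Proof. by []. Qed.

Lemma fps_deriv1 : fps_deriv (1 : fps R) = 0.
Proof. by apply/fpsP => n; rewrite coef_fps_deriv coef_fps1 mul0rn. Qed.

Lemma fps_derivX : fps_deriv (fpsX R) = 1.
Proof.
by apply/fpsP => -[|n]; rewrite coef_fps_deriv coef_fps1 ?mulr1n ?mul0rn.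
Qed.

Lemma fps_derivM f g :
  fps_deriv (f * g) = fps_deriv f * g + f * fps_deriv g.
Proof.
apply/fpsP => n; rewrite coef_fpsD coef_fps_deriv !coef_fpsM.
(* The weight [n.+1] splits as [j + (n.+1 - j)]. The first sum then loses its term [j = 0] and the
   second its term [j = n.+1], which aligns both with sums over [j < n.+1]. *)
have -> : (\sum_(j < n.+2) f j * g (n.+1 - j)%N) *+ n.+1 =
    \sum_(j < n.+2) (f j *+ j) * g (n.+1 - j)%N +
    \sum_(j < n.+2) f j * (g (n.+1 - j)%N *+ (n.+1 - j)).
  rewrite -big_split -sumrMnl; apply: eq_bigr => j _ /=.
  by rewrite mulrnAl mulrnAr -mulrnDr subnKC // -ltnS.
congr (_ + _).
  by rewrite big_ord_recl mulr0n mul0r add0r; apply: eq_bigr => j _.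
rewrite big_ord_recr /= subnn mulr0n mulr0 addr0.
by apply: eq_bigr => j _; rewrite subSn // -ltnS.
Qed.

Lemma fps_derivXn f n :
  fps_deriv (f ^+ n.+1) = (f ^+ n * fps_deriv f) *+ n.+1.
Proof.
elim: n => [|n IHn]; first by rewrite expr1 expr0 mul1r.
rewrite exprS fps_derivM {}IHn [RHS]mulrS mulrnAr mulrA -exprS.
by rewrite [fps_deriv f * _]mulrC.
Qed.

Lemma coef_fpsMn f n m : (f *+ m) n = f n *+ m.
Proof. by elim: m => // m IHm; rewrite !mulrS coef_fpsD IHm. Qed.

Lemma fps_deriv_comp f g : g 0%N = 0 ->
  fps_deriv (fps_comp f g) = fps_comp (fps_deriv f) g * fps_deriv g.
Proof.
move=> g0; apply/fpsP => n; rewrite coef_fps_deriv coef_fps_comp coef_fpsM.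
rewrite -sumrMnl big_ord_recl expr0 coef_fps1 mulr0 mul0rn add0r.
(* As [g 0%N = 0], every inner composite sum can be taken over the same range [k < n.+1]. The two
   sums can then be exchanged, and the power rule is applied for each [k]. *)
under [RHS]eq_bigr => j _.
  rewrite (fps_comp_wide _ g0 (ltn_ord j)) mulr_suml.
  over.
rewrite exchange_big; apply: eq_bigr => k _.
rewrite lift0 -mulrnAr -coef_fps_deriv fps_derivXn coef_fpsMn coef_fpsM.
rewrite mulrnAr -mulrnAl mulr_sumr.
by apply: eq_bigr => j _; rewrite mulrA.
Qed.

Lemma fps_deriv_at0E k f : fps_deriv_at0 k f = f k *+ k`!.
Proof.
rewrite /fps_deriv_at0; elim: k f => // k IHk f.
by rewrite iterSr IHk coef_fps_deriv -mulrnA factS.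
Qed.

End Derivative.

Section Map.
Variables (R S : comNzRingType) (phi : {rmorphism R -> S}).
Implicit Types f g : fps R.

Fact map_fps_is_additive : additive (map_fps phi).
Proof. by move=> f g; apply/fpsP => n; rewrite /= rmorphB. Qed.

Fact map_fps_is_monoid_morphism : monoid_morphism (map_fps phi).
Proof.
split=> [|f g]; apply/fpsP => n; first by case: n => [|n] /=; rewrite ?rmorph1 ?rmorph0.
by rewrite /= rmorph_sum; apply: eq_bigr => j _; rewrite rmorphM.
Qed.

(** The morphism structure carries identities between series over the base field to series with
    coefficients polynomial in x. *)
HB.instance Definition _ := GRing.isZmodMorphism.Build (fps R) (fps S)
  (map_fps phi) map_fps_is_additive.
HB.instance Definition _ := GRing.isMonoidMorphism.Build (fps R) (fps S)
  (map_fps phi) map_fps_is_monoid_morphism.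

Lemma fps_deriv_map f : fps_deriv (map_fps phi f) = map_fps phi (fps_deriv f).
Proof. by apply/fpsP => n; rewrite /= rmorphMn. Qed.

End Map.

Section UnitRing.
Variable R : comUnitRingType.
Implicit Types f g h : fps R.

(** Obtained by differentiating [f^-1 * f = 1]. The right-hand side is arranged so that the
    logarithmic derivative of [f] is visible. *)
Lemma fps_derivV f : f \is a GRing.unit ->
  fps_deriv f^-1 = - (fps_deriv f / f) / f.
Proof.
move=> Uf; apply: (mulIr Uf); rewrite mulrVK //; apply/eqP.
rewrite -addr_eq0 [fps_deriv f / f]mulrC -fps_derivM mulVr //.
by rewrite fps_deriv1.
Qed.

(** The coefficients [1 / n!] are ring inverses. Assuming only that the positive integers are units
    lets the lemma apply over [{poly K}], which is not a field. *)
Lemma fps_deriv_exp : (forall n, n.+1%:R \is a @GRing.unit R) ->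
  fps_deriv (fps_exp R) = fps_exp R.
Proof.
move=> UR; apply/fpsP => n; rewrite /= factS natrM -[LHS]mulr_natr.
have Uf m : m`!%:R \is a @GRing.unit R.
  by elim: m => [|m IHm]; rewrite ?unitr1 // factS natrM unitrM UR.
by rewrite invrM // mulrVK.
Qed.

(** Differentiating h(g(y)) = y gives h'(g) g' = 1, which yields both the invertibility and the
    value. *)
Lemma fps_deriv_compinv h g : is_fps_compinv h g ->
  fps_comp (fps_deriv h) g \is a GRing.unit /\
  fps_deriv g = (fps_comp (fps_deriv h) g)^-1.
Proof.
move=> [g0 hg _]; have := fps_deriv_comp h g0.
rewrite hg fps_derivX => /esym e1.
have U : fps_comp (fps_deriv h) g \is a GRing.unit.
  by apply/unitrPr; exists (fps_deriv g).
by split=> //; apply: (mulrI U); rewrite mulrV.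
Qed.

End UnitRing.

Section ShefferAppell.
Variable K : fieldType.
Hypothesis char0 : [pchar K] =i pred0.
Variables (l h : fps K) (sA : nat -> {poly K}).
Hypotheses (hdelta : delta_series h) (linv : invertible_series l).
Hypothesis hsA : sheffer_appell l h sA.

Let g := fps_compinv h.
Let h' := fps_deriv h.
Let l' := fps_deriv l.
Let A := (fps_comp h' g)^-1.
Let B := - (l' / l).
Let C := - (fps_comp l' g / (fps_comp h' g * fps_comp l g)).

Let natr_neq0 n : n.+1%:R != 0 :> K.
Proof. by rewrite (iffLR (pcharf0P _) char0). Qed.

Let F : fps {poly K} := Fps (fun n => (n`!%:R)^-1 *: sA n).
Let P : fps {poly K} := fpsC 'X * map_fps polyC A + map_fps polyC (B + C).

Lemma deriv_sheffer_appell_series : fps_deriv F = P * F.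
Proof.
have [h0 h1] := hdelta; rewrite coef_fps_deriv mulr1n in h1.
have hg : is_fps_compinv h g by apply: fps_compinvP; rewrite ?unitfE.
have [Uhg dg] := fps_deriv_compinv hg; have [g0 _ _] := hg.
have Ul : l \is a GRing.unit by rewrite unit_fpsE unitfE.
have Ulg : fps_comp l g \is a GRing.unit.
  by rewrite unit_fpsE fps_comp_coef0 unitfE.
(* [B + C] is minus the logarithmic derivative of l(g) l, the denominator of the generating
   function; [A] enters [C] as g'. *)
have BC : B + C = - (fps_deriv (fps_comp l g * l) / (fps_comp l g * l)).
  rewrite fps_derivM fps_deriv_comp // dg mulrDl opprD addrC /B /C.
  rewrite !invrM // -/h' -/l' -/A; congr (- _ - _).
    by rewrite [RHS]mulrA mulrK // -mulrA (mulrC A).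
  by rewrite (mulrC l^-1) [RHS]mulrA [fps_comp l g * l']mulrC mulrK.
have Xg0 : (fpsC 'X * map_fps polyC g) 0%N = 0.
  by rewrite coef_fpsCM /= g0 polyC0 mulr0.
have UP n : n.+1%:R \is a @GRing.unit {poly K}.
  by rewrite -(rmorph_nat polyC) rmorph_unit // unitfE.
(* The indeterminate x is a constant for differentiation in y. *)
have dX : fps_deriv (fpsC 'X : fps {poly K}) = 0.
  by apply/fpsP => n; rewrite coef_fps_deriv mul0rn.
(* In the product rule, the factor 1 / (l(g) l) contributes [B + C] and the exponential contributes
   x g', that is ['X] times [A]. *)
rewrite /F -hsA fps_derivM fps_deriv_map fps_derivV ?unitrM ?Ulg //.
rewrite -BC rmorphM fps_deriv_comp // fps_deriv_exp //.
rewrite fps_derivM dX mul0r add0r fps_deriv_map dg -/A /P.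
by ring.
Qed.

Lemma sheffer_appell_rec n : sA n.+1 = \sum_(k < n.+1)
  'C(n, k)%:R * ('X * (fps_deriv_at0 k A)%:P + (fps_deriv_at0 k B)%:P
    + (fps_deriv_at0 k C)%:P) * sA (n - k)%N.
Proof.
have Ufact m : m`!%:R != 0 :> K.
  by rewrite -(prednK (fact_gt0 m)) natr_neq0.
have /fpsP/(_ n) := deriv_sheffer_appell_series.
(* The left coefficient is [sA n.+1] times (n+1) / (n+1)! = 1 / n!, so both sides are multiplied by
   n!. *)
rewrite coef_fps_deriv /= -scaler_nat scalerA factS natrM invfM mulrA.
rewrite divff ?natr_neq0 // mul1r => /(congr1 ( *:%R n`!%:R)).
rewrite scalerA divff // scale1r => ->.
rewrite scaler_sumr; apply: eq_bigr => k _.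
have kn : (k <= n)%N by rewrite -ltnS.
(* The three derivatives at 0 share the factor k!, so the bracket is k! times the coefficient
   [P k]. *)
rewrite !fps_deriv_at0E !rmorphMn /= mulrnAr -!mulrnDl -addrA -polyCD.
have -> : 'X * (A k)%:P + (B k + C k)%:P = P k.
  by rewrite coef_fpsD coef_fpsCM.
(* What remains is n! / (n-k)! = C(n,k) k!. *)
rewrite mulr_natl -mulrnA mulrnAl -scalerAr scalerA -(bin_fact kn).
by rewrite mulnA natrM mulfK // scaler_nat mulnC.
Qed.

End ShefferAppell.

Theorem theorem4 (R : realType) (l h : fps R[i]) (sA : nat -> {poly R[i]})
    (hdelta : delta_series h) (linv : invertible_series l)
    (hsA : sheffer_appell l h sA) (n : nat) :
  let hinv := fps_compinv h in
  let h' := fps_deriv h in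
  let l' := fps_deriv l in
  let a k := fps_deriv_at0 k (fps_comp h' hinv)^-1 in
  let b k := fps_deriv_at0 k (- (l' / l)) in
  let c k := fps_deriv_at0 k
    (- (fps_comp l' hinv / (fps_comp h' hinv * fps_comp l hinv))) in
  sA n.+1 = \sum_(k < n.+1)
    'C(n, k)%:R * ('X * (a k)%:P + (b k)%:P + (c k)%:P) * sA (n - k)%N.
Proof. exact: (sheffer_appell_rec (Num.Theory.pchar_num _)). Qed.
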